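(* Let $m,n\in\mathbb{N}$ be such that $m\leq n$ and let $A$ be an invertible bounded operator on a complex Hilbert space. Then the following conditions are equivalent: (i) both $A$ and $A^*$ satisfy the system, that is, $(A^* )^sA^s=(A^*A)^s$ and $A^s(A^* )^s=(AA^* )^s$ for all $s\in\{m,\,n,\,m+n\}$; (ii) $A$ is normal.
   Context: $\mathbb{N}$ denotes the set of positive integers. Invertible means having a bounded everywhere defined inverse. *)

(* Defs.v *)
From HB Require Import structures.
From mathcomp Require Import all_boot all_order all_algebra.
From mathcomp Require Import complex sesquilinear.
From mathcomp Require Import all_classical all_reals all_analysis.

Set Implicit Arguments.
Unset Strict Implicit.
Unset Printing Implicit Defensive.

Import Order.TTheory GRing.Theory Num.Theory.
Import numFieldNormedType.Exports.

Local Open Scope classical_set_scope.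
Local Open Scope ring_scope.
Local Open Scope complex_scope.

(* The inner product is linear in its first argument and conjugate-linear in
   the second. Completeness is that of the uniform structure of the norm, which
   inner_normE forces to be the norm induced by the inner product. *)
HB.mixin Record CompleteNormedModule_isHilbert (R : realType) H
    of CompleteNormedModule R[i] H := {
  inner : {dot H for (@Num.conj R[i])} ;
  inner_normE : forall x : H, inner x x = `|x| ^+ 2
}.

#[short(type="hilbertType")]
HB.structure Definition Hilbert (R : realType) :=
  {H of CompleteNormedModule R[i] H & CompleteNormedModule_isHilbert R H}.

Section operators.
Variables (R : realType) (H : hilbertType R).
Implicit Types A : H -> H.

Definition bounded_operator A :=
  linear A /\ exists M : R, forall x : H, `|A x| <= M%:C * `|x|.

Definition invertible_operator A :=
  exists B : H -> H, [/\ bounded_operator B, cancel A B & cancel B A].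

(* For a bounded operator, the vector selected at y exists by the Riesz
   representation theorem and is unique by definiteness of the inner product;
   the default value of get is then irrelevant. *)
Definition adjoint A : H -> H :=
  fun y => get [set z : H | forall x : H, inner (A x) y = inner x z].

Definition normal_operator A := adjoint A \o A = A \o adjoint A.

End operators.

(* Main.v *)
Require Import Defs.
From mathcomp Require Import all_boot all_order all_algebra.
From mathcomp Require Import complex sesquilinear.
From mathcomp Require Import all_classical all_reals all_analysis.
From mathcomp Require Import ring lra.
(** Put P = A*A and Q = AA*.  Comparing the exponents m, n and m+n and cancelling
    the injective (A* )^m shows that A^m commutes with P^n.  A Sylvester-type
    argument extracts roots: if P^k X = X Q^k with P, Q positive and invertible,
    then PX = XQ.  Hence A^m commutes with P = A*A, so with A* because A is onto;
    this gives P^m = Q^m, and the same argument with X = 1 gives P = Q.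

    For the root extraction, D = PX - XQ satisfies sum_i P^i D Q^(k-1-i) = 0, and
    this sum is a product of the commuting maps Y |-> PY - w YQ applied to D, where
    w runs over the k-th roots of unity other than 1.  Each factor is injective: a
    disc around a multiple of w - 1 separates the spectrum of wQ from that of P. *)

Set Implicit Arguments.
Unset Strict Implicit.
Unset Printing Implicit Defensive.

Import Order.TTheory GRing.Theory Num.Theory.
Import numFieldNormedType.Exports.

Local Open Scope classical_set_scope.
Local Open Scope ring_scope.
Local Open Scope complex_scope.

(** * Real inner product, Cauchy-Schwarz and Riesz representation *)

Section InnerProduct.
Variables (R : realType) (H : hilbertType R).
Implicit Types (x y z : H) (a b : R[i]) (r : R).

Definition rdot x y : R := complex.Re (inner x y).
Definition rnorm x : R := complex.Re `|x|.

Lemma normE x : `|x| = (rnorm x)%:C.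
Proof. by rewrite /rnorm RRe_real// normr_real. Qed.

Lemma rnorm_ge0 x : 0 <= rnorm x.
Proof. by rewrite -ler0c -normE. Qed.

Lemma rnorm_sqr x : rnorm x ^+ 2 = rdot x x.
Proof. by rewrite /rdot inner_normE normE -rmorphXn. Qed.

Lemma rnorm0_eq0 x : rnorm x = 0 -> x = 0.
Proof. by move=> x0; apply/eqP; rewrite -normr_eq0 normE x0. Qed.

Lemma innerC x y : inner x y = (inner y x)^*.
Proof. by rewrite (hermC inner) expr0 mul1r. Qed.

Lemma innerDl x y z : inner (x + y) z = inner x z + inner y z.
Proof. exact: linearDl. Qed.
Lemma innerBl x y z : inner (x - y) z = inner x z - inner y z.
Proof. exact: linearBl. Qed.
Lemma innerDr x y z : inner x (y + z) = inner x y + inner x z.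
Proof. exact: linearDr. Qed.
Lemma innerBr x y z : inner x (y - z) = inner x y - inner x z.
Proof. exact: linearBr. Qed.
Lemma innerZl a x y : inner (a *: x) y = a * inner x y.
Proof. exact: linearZl_LR. Qed.
Lemma innerZr a x y : inner x (a *: y) = a^* * inner x y.
Proof. exact: linearZr_LR. Qed.

Lemma rdotC x y : rdot x y = rdot y x.
Proof. by rewrite /rdot innerC; case: (inner y x). Qed.
Lemma rdotDl x y z : rdot (x + y) z = rdot x z + rdot y z.
Proof. by rewrite /rdot innerDl raddfD. Qed.
Lemma rdotBl x y z : rdot (x - y) z = rdot x z - rdot y z.
Proof. by rewrite /rdot innerBl raddfB. Qed.
Lemma rdotZl r x y : rdot (r%:C *: x) y = r * rdot x y.
Proof. by rewrite /rdot innerZl; case: (inner x y) => u v /=; rewrite mul0r subr0. Qed.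
Lemma rdotDr x y z : rdot x (y + z) = rdot x y + rdot x z.
Proof. by rewrite !(rdotC x) rdotDl. Qed.
Lemma rdotBr x y z : rdot x (y - z) = rdot x y - rdot x z.
Proof. by rewrite !(rdotC x) rdotBl. Qed.
Lemma rdotZr r x y : rdot x (r%:C *: y) = r * rdot x y.
Proof. by rewrite !(rdotC x) rdotZl. Qed.

Lemma rdot_il x y : rdot ('i *: x) y = - complex.Im (inner x y).
Proof. by rewrite /rdot innerZl mulrC ReiNIm. Qed.

Lemma rdot_inj y z : (forall x, rdot x y = rdot x z) -> y = z.
Proof.
move=> yz; apply/eqP; rewrite -subr_eq0; apply/eqP/rnorm0_eq0.
by apply/eqP; rewrite -sqrf_eq0 rnorm_sqr rdotBr yz subrr.
Qed.

Lemma CauchySchwarz_rdot x y : `|rdot x y| <= rnorm x * rnorm y.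
Proof.
have [y0|y0] := eqVneq (rnorm y) 0.
  by rewrite (rnorm0_eq0 y0) /rdot linear0r normr0 mulr_ge0 ?rnorm_ge0.
have ny : 0 < rnorm y by rewrite lt_def y0 rnorm_ge0.
rewrite -ler_sqr ?nnegrE ?mulr_ge0 ?rnorm_ge0// real_normK ?num_real//.
(* This squared norm expands to |y|^2 (|x|^2 |y|^2 - <x,y>^2). *)
have := sqr_ge0 (rnorm ((rdot y y)%:C *: x - (rdot x y)%:C *: y)).
rewrite rnorm_sqr !(rdotBl, rdotBr, rdotZl, rdotZr) (rdotC y x).
rewrite exprMn !rnorm_sqr.
have : 0 < rdot y y by rewrite -rnorm_sqr exprn_gt0.
nra.
Qed.


(** Variational proof: completeness yields a minimizer of a quadratic functional. Bounding the real
    part of [f] suffices, since the imaginary part is recovered from f(ix). *)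
Lemma riesz (f : H -> R[i]) (M : R) :
  (forall a x y, f (a *: x + y) = a * f x + f y) ->
  (forall x, `|complex.Re (f x)| <= M * rnorm x) ->
  exists z, forall x, f x = inner x z.
Proof.
move=> flin fM.
have f0 : f 0 = 0.
  by have := flin (-1) 0 0; rewrite scaler0 add0r mulN1r addNr.
pose g x := complex.Re (f x).
have gD x y : g (x + y) = g x + g y.
  by rewrite /g -[x]scale1r flin mul1r scale1r raddfD.
have gZ r x : g (r%:C *: x) = r * g x.
  rewrite /g -[_ *: x]addr0 flin f0 addr0; case: (f x) => u v /=.
  by rewrite mul0r subr0.
(* J is |x|^2 - 2 Re f(x); its minimizer is the representing vector. *)
pose J x := rdot x x - 2 * g x.
have Jge x : - M ^+ 2 <= J x.
  have := fM x; rewrite -/(g x) ler_norml => /andP[_].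
  have := sqr_ge0 (rnorm x - M); rewrite /J -rnorm_sqr; nra.
pose d := inf (range J).
have Jinf : has_inf (range J).
  split; first by exists (J 0), 0.
  by exists (- M ^+ 2) => _ [x _ <-].
have dJ x : d <= J x by apply: ge_inf; [case: Jinf | exists x].
pose S (e : R) := [set z | J z <= d + e ^+ 2].
have S_ex (e : R) : 0 < e -> exists z, S e z.
  move=> e0; have e2 : 0 < e ^+ 2 by rewrite exprn_gt0.
  have [_ [z _ <-] Jz] := inf_adherent e2 Jinf.
  by exists z; exact: ltW.
(* Parallelogram law at the midpoint: |z - w|^2 = 2 J(z) + 2 J(w) - 4 J((z + w)/2), which is at most
   4 e^2. *)
have S_diam (e : R) z w : 0 < e -> S e z -> S e w -> rnorm (z - w) <= 2 * e.
  move=> e0; rewrite /S /= => Jz Jw.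
  rewrite -ler_sqr ?nnegrE ?rnorm_ge0 ?mulr_ge0 ?(ltW e0)//.
  have := dJ ((2^-1)%:C *: (z + w)).
  rewrite rnorm_sqr; move: Jz Jw; rewrite /J gZ gD.
  rewrite !(rdotZl, rdotZr, rdotBl, rdotBr, rdotDl, rdotDr) (rdotC w z) exprMn.
  by lra.
(* Approximate Euler-Lagrange equation: J(tx + z) >= d for all t makes a quadratic in t nonnegative,
   and its value at the vertex bounds the linear coefficient. *)
have S_dot (e : R) z x : 0 < e -> S e z -> `|rdot x z - g x| <= e * rnorm x.
  move=> e0 Sz.
  have Jt t : 0 <= t ^+ 2 * rnorm x ^+ 2 + 2 * t * (rdot x z - g x) + e ^+ 2.
    have := dJ (t%:C *: x + z); move: Sz; rewrite /S /= /J gD gZ.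
    rewrite !(rdotZl, rdotZr, rdotDl, rdotDr) (rdotC z x) rnorm_sqr.
    by nra.
  set b := rdot x z - g x in Jt *.
  rewrite -ler_sqr ?nnegrE ?mulr_ge0 ?rnorm_ge0 ?(ltW e0)//.
  rewrite real_normK ?num_real// exprMn.
  have [x0|x0] := eqVneq (rnorm x) 0.
    rewrite /b (rnorm0_eq0 x0) /rdot linear0l /g f0 /= subrr expr0n/=.
    by rewrite mulr_ge0// sqr_ge0.
  have nx : 0 < rnorm x ^+ 2 by rewrite exprn_gt0// lt_def x0 rnorm_ge0.
  have := Jt (- b / rnorm x ^+ 2).
  set N := rnorm x ^+ 2 in nx *.
  have -> : (- b / N) ^+ 2 * N + 2 * (- b / N) * b + e ^+ 2 =
    (e ^+ 2 * N - b ^+ 2) / N by field; rewrite gt_eqF.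
  by rewrite pmulr_lge0 ?invr_gt0// subr_ge0.
(* The nested sets of near-minimizers generate a Cauchy filter, which replaces a minimizing
   sequence. *)
pose F : set_system H := filter_from [set e : R | 0 < e] S.
have FF : ProperFilter F.
  apply: filter_from_proper => //; apply: filter_from_filter.
    by exists 1 => /=.
  move=> e1 e2 /= e10 e20; exists (Num.min e1 e2); first by rewrite /= lt_min e10.
  move=> z; rewrite /S /=.
  have me : 0 < Num.min e1 e2 by rewrite lt_min e10.
  move=> Jz; split; apply: (le_trans Jz); rewrite lerD2l;
    by rewrite ler_sqr ?nnegrE ?(ltW e10) ?(ltW e20) ?(ltW me)// ge_min lexx ?orbT.
have Fc : cauchy F.
  apply: cauchy_exP => eps eps0.
  have e0 : 0 < complex.Re eps by move: eps0; rewrite ltcE => /andP[].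
  have epsE : eps = (complex.Re eps)%:C by rewrite RRe_real// gtr0_real.
  have e3 : 0 < complex.Re eps / 3 by rewrite divr_gt0.
  have [z Sz] := S_ex _ e3.
  exists z; exists (complex.Re eps / 3) => // w Sw.
  rewrite -ball_normE /ball_ /= normE epsE ltcR.
  by apply: le_lt_trans (S_diam _ _ _ e3 Sz Sw) _; lra.
have [z Fz] := (cvg_ex F).1 (cauchy_cvg _ Fc).
exists z.
have gz x : g x = rdot x z.
  apply/eqP; rewrite eq_sym -subr_eq0 -normr_le0; apply/ler_addgt0Pr => e e0.
  rewrite add0r.
  (* Near-minimality and distance to [z] each contribute e'|x|; the added 1 keeps the denominator
     positive. *)
  pose e' := e / (2 * rnorm x + 1).
  have nx := rnorm_ge0 x.
  have e'0 : 0 < e' by rewrite divr_gt0// ltr_wpDl// mulr_ge0.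
  have [w [Sw zw]] : (S e' `&` ball z e'%:C) !=set0.
    apply: (@filter_ex _ F); apply: filterI; first by exists e'.
    by apply: Fz; apply: nbhsx_ballx; rewrite ltcR.
  move: zw; rewrite -ball_normE /ball_ /= normE ltcR => zw.
  have -> : rdot x z - g x = rdot x (z - w) + (rdot x w - g x).
    by rewrite rdotBr; ring.
  apply: le_trans (ler_normD _ _) _.
  have -> : e = e' * (2 * rnorm x + 1).
    by rewrite /e' divfK// gt_eqF// ltr_wpDl// mulr_ge0.
  have := CauchySchwarz_rdot x (z - w); have := S_dot _ _ x e'0 Sw; nra.
move=> x; apply/eqP; rewrite eq_complex -!/(g _) -/(rdot _ _) gz eqxx /=.
(* Applying [gz] to ix compares the imaginary parts. *)
have := gz ('i *: x); rewrite rdot_il /g.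
rewrite -[_ *: x]addr0 flin f0 addr0 mulrC ReiNIm => /oppr_inj ->.
by [].
Qed.

End InnerProduct.

(** * Bounded operators and their adjoints *)

Section BoundedOperators.
Variables (R : realType) (H : hilbertType R).
Implicit Types (A B P Q X Y T : H -> H) (x y : H) (w z : R[i]).

Lemma linear_fun0 A : linear A -> A 0 = 0.
Proof. by move=> lA; have := lA (-1) 0 0; rewrite scaler0 add0r scaleN1r addNr. Qed.

Lemma linear_funZ A : linear A -> forall z x, A (z *: x) = z *: A x.
Proof. by move=> lA z x; rewrite -[z *: x]addr0 lA linear_fun0// addr0. Qed.

Lemma linear_funB A : linear A -> forall x y, A (x - y) = A x - A y.
Proof. by move=> lA x y; rewrite -scaleN1r addrC lA scaleN1r addrC. Qed.

Lemma bounded_rnorm A : bounded_operator A ->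
  exists2 M : R, 0 <= M & forall x, rnorm (A x) <= M * rnorm x.
Proof.
move=> [_ [M AM]]; exists (Num.max 0 M); first by rewrite le_max lexx.
move=> x; have := AM x; rewrite !normE -rmorphM lecR => /le_trans; apply.
by rewrite ler_wpM2r ?rnorm_ge0// le_max lexx orbT.
Qed.

Lemma rnorm_bounded A (M : R) : linear A ->
  (forall x, rnorm (A x) <= M * rnorm x) -> bounded_operator A.
Proof.
by move=> lA AM; split=> //; exists M => x; rewrite !normE -rmorphM lecR.
Qed.

Lemma bounded_id : bounded_operator (@id H).
Proof. by apply: (@rnorm_bounded _ 1) => // x; rewrite mul1r. Qed.

Lemma bounded_comp A B :
  bounded_operator A -> bounded_operator B -> bounded_operator (A \o B).
Proof.
move=> bA bB; have [M M0 AM] := bounded_rnorm bA.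
have [K K0 BK] := bounded_rnorm bB.
apply: (@rnorm_bounded _ (M * K)) => [z x y /=|x /=].
  by rewrite (bB.1) (bA.1).
by apply: le_trans (AM _) _; rewrite -mulrA ler_wpM2l.
Qed.

Lemma bounded_iter n A : bounded_operator A -> bounded_operator (iter n A).
Proof.
by move=> bA; elim: n => [|n IHn]; [exact: bounded_id | exact: bounded_comp].
Qed.

Lemma bounded_subZ z A B : bounded_operator A -> bounded_operator B ->
  bounded_operator (fun x => A x - z *: B x).
Proof.
move=> bA bB; have [M M0 AM] := bounded_rnorm bA.
have [K K0 BK] := bounded_rnorm bB.
apply: (@rnorm_bounded _ (M + complex.Re `|z| * K)) => [u x y|x].
  rewrite bA.1 bB.1 scalerDr scalerBr opprD addrACA; congr (_ - _ + _).
  by rewrite !scalerA mulrC.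
rewrite -lecR -normE; apply: le_trans (ler_normB _ _) _.
rewrite normrZ !normE mulrDl rmorphD lerD ?lecR//.
rewrite -[`|z|]RRe_real ?normr_real// -rmorphM lecR -mulrA ler_wpM2l//.
by rewrite -ler0c RRe_real ?normr_real.
Qed.

(** By Riesz representation the set in [adjoint] is nonempty, so [get] picks one of its elements
    rather than a default. *)
Lemma inner_adjoint A : bounded_operator A ->
  forall x y, inner (A x) y = inner x (adjoint A y).
Proof.
move=> bA x y; have [M M0 AM] := bounded_rnorm bA.
rewrite /adjoint; have [|u|z zE] := @riesz R H (fun x => inner (A x) y) (M * rnorm y).
- by move=> a u v; rewrite bA.1 innerDl innerZl.
- apply: le_trans (CauchySchwarz_rdot _ _) _.
  by rewrite mulrAC ler_wpM2r ?rnorm_ge0.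
- by rewrite (@getPex _ [set z | forall x, inner (A x) y = inner x z])//; exists z.
Qed.

Lemma rdot_adjoint A : bounded_operator A ->
  forall x y, rdot (A x) y = rdot x (adjoint A y).
Proof. by move=> bA x y; rewrite /rdot inner_adjoint. Qed.

Lemma bounded_adjoint A : bounded_operator A -> bounded_operator (adjoint A).
Proof.
move=> bA; have [M M0 AM] := bounded_rnorm bA.
apply: (@rnorm_bounded _ M) => [z x y|y].
  apply: rdot_inj => u; rewrite /rdot innerDr innerZr.
  by rewrite -!inner_adjoint// innerDr innerZr.
have [->|y0] := eqVneq (rnorm (adjoint A y)) 0; first by rewrite mulr_ge0 ?rnorm_ge0.
have ny : 0 < rnorm (adjoint A y) by rewrite lt_def y0 rnorm_ge0.
rewrite -(ler_pM2l ny) -expr2 rnorm_sqr -rdot_adjoint//.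
apply: le_trans (ler_norm _) (le_trans (CauchySchwarz_rdot _ _) _).
by rewrite mulrA ler_wpM2r ?rnorm_ge0// mulrC.
Qed.

(** * Injectivity of Sylvester maps for positive operators *)

Definition selfadjoint T := forall x y, inner (T x) y = inner x (T y).

(** For c > 0 and [T] selfadjoint, this is the quantitative form of positive and invertible. *)
Definition coercive (c : R) T := forall x, c * rnorm x ^+ 2 <= rdot (T x) x.

(** Selfadjointness makes <Tx,x> real, so only Re z enters the cross term. *)
Lemma rnorm_shift T z x : selfadjoint T ->
  rnorm (T x - z *: x) ^+ 2 = rnorm (T x) ^+ 2 -
  2 * complex.Re z * rdot (T x) x +
  (complex.Re z ^+ 2 + complex.Im z ^+ 2) * rnorm x ^+ 2.
Proof.
move=> sT; rewrite !rnorm_sqr /rdot !innerBl !innerBr !innerZl !innerZr -(sT x x).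
have := inner_normE x; have := innerC (T x) x; rewrite -(sT x x).
rewrite normE -rmorphXn => + ->.
case: z (inner (T x) x) (inner (T x) (T x)) => [a b] [p q] [r s] /= [].
move=> q0; simpc => /=; have -> : q = 0 by lra.
ring.
Qed.

(** By Bernoulli's inequality the powers of q are unbounded. *)
Lemma geometric_bound_eq0 (q a b : R) : 1 < q -> 0 <= a ->
  (forall k, q ^+ k * a <= b) -> a = 0.
Proof.
move=> q1 a0 qab; have bernoulli k : 1 + k%:R * (q - 1) <= q ^+ k.
  elim: k => [|k IHk]; first by rewrite mul0r addr0.
  rewrite exprS -natr1; apply: le_trans (ler_wpM2l (ltW (lt_trans ltr01 q1)) IHk).
  have := mulr_ge0 (ler0n R k) (sqr_ge0 (q - 1)); nra.
apply/eqP; apply: contraT => an0.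
have a_gt0 : 0 < (q - 1) * a by rewrite mulr_gt0 ?subr_gt0// lt_def an0.
have := truncnS_gt (b / ((q - 1) * a)); set k := (_.+1)%N.
rewrite ltr_pdivrMr// ltNge => /negP[]; apply: le_trans (qab k).
by rewrite mulrA ler_wpM2r//; have := bernoulli k; lra.
Qed.

(** The spectra of P and wQ lie on two distinct open rays from the origin, so PY = Y(wQ) forces Y =
    0. Norm growth under powers replaces any use of the spectrum. *)
Lemma intertwiner_eq0 P Q Y (c : R) w :
  bounded_operator Q -> bounded_operator Y ->
  selfadjoint P -> selfadjoint Q -> 0 < c -> coercive c P -> coercive c Q ->
  `|w| = 1 -> w != 1 ->
  (forall x, P (Y x) = w *: Y (Q x)) -> forall x, Y x = 0.
Proof.
move=> bQ bY sP sQ c0 cP cQ w1 wn1 PY.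
have [M M0 QM] := bounded_rnorm bQ.
have [K K0 YK] := bounded_rnorm bY.
set u := complex.Re w; set v := complex.Im w.
have uv : u ^+ 2 + v ^+ 2 = 1.
  by apply: complexI; rewrite add_Re2_Im2 w1 expr1n.
have u1 : u < 1.
  rewrite lt_def; apply/andP; split.
    apply: contra wn1 => /eqP u1; rewrite eq_complex -/u -/v /= -u1 eqxx /=.
    by rewrite -sqrf_eq0; apply/eqP; move: uv; rewrite -u1; lra.
  by rewrite leNgt; apply/negP => u1; have := sqr_ge0 v; nra.
pose a := 1 - u; have a0 : 0 < a by rewrite subr_gt0.
(* With this [t] the cross terms 2ta<Px,x> and 2ta<Qx,x> are at least (M^2 + 1)|x|^2: the M^2
   absorbs |Qx|^2, and the 1 keeps t > 0 and the growth strict even if M = 0. *)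
pose t := (M ^+ 2 + 1) / (2 * a * c).
have tac : 2 * t * a * c = M ^+ 2 + 1 by rewrite /t; field; rewrite !gt_eqF.
have t0 : 0 < t by rewrite divr_gt0 ?mulr_gt0// ltr_wpDl// sqr_ge0.
(* On the disc of radius |z| around z: w Q - z is a contraction by |z|, while P - z
   expands by more than |z|; hence (P - z)^k Y = Y (w Q - z)^k forces Y = 0. *)
pose z : R[i] := t%:C * (w - 1).
have wE : w = u +i* v by rewrite /u /v; case: (w).
have zE : z = (- (t * a)) +i* (t * v).
  by rewrite /z wE; simpc; congr (_ +i* _); rewrite /a; ring.
(* Multiplication by w^* flips the sign of Re z, so the cross term that enlarges P - z shrinks Q -
   w^* z. *)
have z'E : w^* * z = (t * a) +i* (t * v).
  rewrite zE wE /a; simpc; congr (_ +i* _).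
    by have : t * (u ^+ 2 + v ^+ 2) = t * 1; [rewrite uv | lra].
  by ring.
(* [r] is |z|^2, because |w - 1|^2 = 2a on the unit circle. *)
pose r := 2 * t ^+ 2 * a.
have r0 : 0 < r by rewrite /r; have := mulr_gt0 (mulr_gt0 t0 t0) a0; lra.
have zr : (t * a) ^+ 2 + (t * v) ^+ 2 = r.
  by rewrite /r /a; have : t ^+ 2 * (u ^+ 2 + v ^+ 2) = t ^+ 2 * 1; [rewrite uv | lra].
pose SP x := P x - z *: x; pose SQ x := w *: Q x - z *: x.
have SPl x : (r + (M ^+ 2 + 1)) * rnorm x ^+ 2 <= rnorm (SP x) ^+ 2.
  rewrite rnorm_shift// zE /= sqrrN zr -tac.
  have := cP x; have := sqr_ge0 (rnorm (P x)).
  have : 0 < t * a by rewrite mulr_gt0.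
  nra.
have SQl x : rnorm (SQ x) ^+ 2 <= r * rnorm x ^+ 2.
  have ww : w * w^* = 1 by rewrite -sqr_normc w1 expr1n.
  have -> : rnorm (SQ x) = rnorm (Q x - (w^* * z) *: x).
    apply: complexI; rewrite -!normE -[RHS]mul1r -w1 -normrZ scalerBr.
    by rewrite scalerA mulrA ww mul1r.
  rewrite rnorm_shift// z'E /= zr.
  have := cQ x; have : 0 < t * a by rewrite mulr_gt0.
  have : rnorm (Q x) ^+ 2 <= M ^+ 2 * rnorm x ^+ 2.
    by rewrite -exprMn ler_sqr ?nnegrE ?mulr_ge0 ?rnorm_ge0.
  have := sqr_ge0 (rnorm x); have := tac.
  nra.
have SPY k x : iter k SP (Y x) = Y (iter k SQ x).
  elim: k => //= k ->; rewrite /SP /SQ PY.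
  by rewrite (linear_funB bY.1) !(linear_funZ bY.1).
have SPk k x : (r + (M ^+ 2 + 1)) ^+ k * rnorm x ^+ 2 <= rnorm (iter k SP x) ^+ 2.
  elim: k => [|k IHk] /=; first by rewrite mul1r.
  apply: le_trans (SPl _); rewrite (exprS _ k) -mulrA ler_wpM2l//.
  by have := sqr_ge0 M; lra.
have SQk k x : rnorm (iter k SQ x) ^+ 2 <= r ^+ k * rnorm x ^+ 2.
  elim: k => [|k IHk] /=; first by rewrite mul1r.
  by apply: le_trans (SQl _) _; rewrite (exprS _ k) -mulrA ler_wpM2l// ltW.
move=> x; apply: rnorm0_eq0; apply/eqP; rewrite -sqrf_eq0; apply/eqP.
apply: (@geometric_bound_eq0 ((r + (M ^+ 2 + 1)) / r) _ (K ^+ 2 * rnorm x ^+ 2)).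
- by rewrite ltr_pdivlMr// mul1r ltrDl ltr_wpDl// sqr_ge0.
- exact: sqr_ge0.
move=> k; rewrite expr_div_n mulrAC ler_pdivrMr ?exprn_gt0//.
apply: le_trans (SPk _ _) _; rewrite SPY.
apply: le_trans (_ : K ^+ 2 * rnorm (iter k SQ x) ^+ 2 <= _).
  by rewrite -exprMn ler_sqr ?nnegrE ?mulr_ge0 ?rnorm_ge0.
by rewrite -[leRHS]mulrA ler_wpM2l ?sqr_ge0// mulrC.
Qed.

End BoundedOperators.

(** * Extraction of roots in intertwining relations *)

Section Sylvester.
Variables (R : realType) (H : hilbertType R).
Implicit Types (A P Q X : H -> H) (x : H) (p : {poly R[i]}).

(* The value of the homogenization of p to degree N at the commuting operators
   Y |-> PY and Y |-> YQ, applied to X. *)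
Definition mixed_horner P Q X p (N : nat) : H -> H := fun x =>
  \sum_(i < N.+1) p`_i *: iter i P (X (iter (N - i) Q x)).

(** Each linear factor of the polynomial acts as one Sylvester map Y |-> PY - wYQ. *)
Lemma mixed_horner_factor P Q X w p N x : linear P -> (size p <= N.+1)%N ->
  mixed_horner P Q X (('X - w%:P) * p) N.+1 x =
  P (mixed_horner P Q X p N x) - w *: mixed_horner P Q X p N (Q x).
Proof.
move=> lP sp; rewrite /mixed_horner.
have lPsum (I : finType) (F : I -> H) : P (\sum_i F i) = \sum_i P (F i).
  apply: (big_morph P) => [u v|]; last exact: linear_fun0.
  by have := lP 1 u v; rewrite !scale1r.
rewrite lPsum scaler_sumr.
under eq_bigr do rewrite mulrBl coefB coefXM mul_polyC coefZ scalerBl.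
rewrite sumrB; congr (_ - _).
  rewrite big_ord_recl /= scale0r add0r; apply: eq_bigr => i _ /=.
  by rewrite subSS linear_funZ.
(* The size bound kills the coefficient of degree [N.+1]. *)
rewrite big_ord_recr /= (nth_default _ sp) mulr0 scale0r addr0.
apply: eq_bigr => i _ /=; rewrite -scalerA; congr (_ *: (_ *: iter i P (X _))).
by rewrite subSn ?iterSr -?(ltnS i).
Qed.

(** The roots are peeled off one at a time: the operator left after removing w satisfies PY = wYQ,
    hence vanishes by [intertwiner_eq0]. *)
Lemma mixed_horner_eq0 P Q X (c : R) (s : seq R[i]) :
  bounded_operator P -> bounded_operator Q -> bounded_operator X ->
  selfadjoint P -> selfadjoint Q -> 0 < c -> coercive c P -> coercive c Q ->
  {in s, forall w, `|w| = 1 /\ w != 1} ->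
  (forall x, mixed_horner P Q X (\prod_(w <- s) ('X - w%:P)) (size s) x = 0) ->
  forall x, X x = 0.
Proof.
move=> bP bQ bX sP sQ c0 cP cQ.
have step w s' x : mixed_horner P Q X (\prod_(w <- w :: s') ('X - w%:P)) (size s').+1 x
   = P (mixed_horner P Q X (\prod_(w <- s') ('X - w%:P)) (size s') x)
    - w *: mixed_horner P Q X (\prod_(w <- s') ('X - w%:P)) (size s') (Q x).
  by rewrite big_cons mixed_horner_factor ?size_prod_XsubC//; exact: bP.1.
have nil_s x : mixed_horner P Q X (\prod_(w <- [::]) ('X - w%:P)) 0 x = X x.
  by rewrite /mixed_horner big_nil big_ord1 coef1 scale1r.
have bM s' : bounded_operator
    (mixed_horner P Q X (\prod_(w <- s') ('X - w%:P)) (size s')).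
  elim: s' => [|w s' IHs].
    by rewrite (_ : mixed_horner _ _ _ _ _ = X)//; apply/funext.
  have := bounded_subZ w (bounded_comp bP IHs) (bounded_comp IHs bQ).
  by congr bounded_operator; apply/funext => x; rewrite [RHS]step.
elim: s => [_ X0 x|w s IHs ws s0]; first by rewrite -nil_s X0.
have [w1 wn1] := ws w (mem_head _ _).
apply: IHs => [v vs|]; first by apply: ws; rewrite inE vs orbT.
apply: (@intertwiner_eq0 _ _ P Q _ c w) => // x.
by apply/eqP; rewrite -subr_eq0 -step s0.
Qed.

(** A root w of q = 1 + X + ... + X^k satisfies w^(k+1) - 1 = (w - 1) q(w) = 0, so |w| = 1; and q(1)
    = k + 1 is nonzero. *)
Lemma cyclotomic_factors (k : nat) : exists s : seq R[i],
  [/\ size s = k, {in s, forall w, `|w| = 1 /\ w != 1} &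
      \prod_(w <- s) ('X - w%:P) = \poly_(i < k.+1) (1 : R[i])].
Proof.
set q := \poly_(i < k.+1) _.
have sq : size q = k.+1 by rewrite size_poly_eq ?oner_eq0.
have lq : lead_coef q = 1 by rewrite lead_coefE sq coef_poly ltnSn.
have [s qE] := closed_field_poly_normal q.
move: qE; rewrite lq scale1r => qE; exists s; split=> //.
  by have := sq; rewrite qE size_prod_XsubC => -[].
move=> w ws.
have qw : \sum_(i < k.+1) w ^+ i = 0.
  have : root q w by rewrite qE root_prod_XsubC.
  rewrite rootE /q poly_def horner_sum => /eqP qw; rewrite -[RHS]qw.
  by apply: eq_bigr => i _; rewrite scale1r hornerXn.
split.
  apply/eqP; rewrite -(@pexpr_eq1 _ _ k.+1)// -normrX.
  suff -> : w ^+ k.+1 = 1 by rewrite normr1.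
  by apply/eqP; rewrite -subr_eq0 subrX1 qw mulr0.
apply: contra_eqN qw => /eqP ->.
under eq_bigr do rewrite expr1n.
by rewrite sumr_const card_ord pnatr_eq0.
Qed.

Lemma intertwiner_pow P Q X (c : R) (m : nat) : (0 < m)%N ->
  bounded_operator P -> bounded_operator Q -> bounded_operator X ->
  selfadjoint P -> selfadjoint Q -> 0 < c -> coercive c P -> coercive c Q ->
  (forall x, iter m P (X x) = X (iter m Q x)) -> forall x, P (X x) = X (Q x).
Proof.
case: m => // k _ bP bQ bX sP sQ c0 cP cQ PXQ x.
pose D x := P (X x) - 1 *: X (Q x).
have bD : bounded_operator D.
  exact: (bounded_subZ 1 (bounded_comp bP bX) (bounded_comp bX bQ)).
have [s [sk sw sq]] := cyclotomic_factors k.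
apply/eqP; rewrite -subr_eq0 -[X (Q x)]scale1r -/(D x); apply/eqP.
apply: (mixed_horner_eq0 bP bQ bD sP sQ c0 cP cQ sw) => {}x.
rewrite sq sk /mixed_horner.
(* P^i D Q^(k-i) = f(i+1) - f(i), so the sum telescopes to P^(k+1) X - X Q^(k+1). *)
pose f i := iter i P (X (iter (k.+1 - i) Q x)).
transitivity (\sum_(0 <= i < k.+1) (f i.+1 - f i)).
  rewrite big_mkord; apply: eq_bigr => i _.
  rewrite coef_poly ltn_ord scale1r /D scale1r.
  rewrite (linear_funB (bounded_iter i bP).1) /f subSS -iterSr -iterS.
  by rewrite subSn// -ltnS.
by rewrite telescope_sumr// /f subn0 subnn; apply/eqP; rewrite subr_eq0 -PXQ.
Qed.

End Sylvester.

(** * From the power identities to normality, and back *)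

Theorem theorem4p4 (R : realType) (H : hilbertType R) (m n : nat)
    (m_gt0 : (0 < m)%N) (le_mn : (m <= n)%N)
    (A : H -> H) (bA : bounded_operator A) (iA : invertible_operator A) :
  (forall s : nat, s \in [:: m; n; (m + n)%N] ->
     iter s (adjoint A) \o iter s A = iter s (adjoint A \o A) /\
     iter s A \o iter s (adjoint A) = iter s (A \o adjoint A))
  <-> normal_operator A.
Proof.
split=> [AS|nA s _]; last first.
  have AA x : adjoint A (A x) = A (adjoint A x) := congr1 (@^~ x) nA.
  have iterC k x : adjoint A (iter k A x) = iter k A (adjoint A x).
    by elim: k x => //= k IHk x; rewrite AA IHk.
  have iterCC k l x : iter l (adjoint A) (iter k A x) = iter k A (iter l (adjoint A) x).
    by elim: l => //= l ->.
  have E k : iter k (adjoint A) \o iter k A = iter k (adjoint A \o A).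
    elim: k => [|k IHk]; apply/funext => x //=.
    by rewrite -IHk /=; congr (adjoint A _); exact: (iterCC 1).
  split=> //; rewrite -[A \o _]nA -E.
  by apply/funext => x /=; rewrite iterCC.
have bA' := bounded_adjoint bA.
have [B [bB AK BK]] := iA.
have [K K0 BM] := bounded_rnorm bB.
have A'_inj : injective (adjoint A).
  move=> x y xy; apply: rdot_inj => u.
  by rewrite -(BK u) !rdot_adjoint// xy.
have iterA'_inj k : injective (iter k (adjoint A)).
  by elim: k => [|k IHk] x y //= /A'_inj/IHk.
have A_low x : rnorm x <= (K + 1) * rnorm (A x).
  by have := BM (A x); rewrite AK; have := rnorm_ge0 (A x); lra.
(* |x|^2 = <A(Bx), x> = <Bx, A* x> <= K |x| |A* x|. *)
have A'_low x : rnorm x <= (K + 1) * rnorm (adjoint A x).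
  have [->|x0] := eqVneq (rnorm x) 0.
    by rewrite mulr_ge0 ?rnorm_ge0// addr_ge0.
  have nx : 0 < rnorm x by rewrite lt_def x0 rnorm_ge0.
  rewrite -(ler_pM2l nx) -expr2 rnorm_sqr -{1}(BK x) rdot_adjoint//.
  apply: le_trans (ler_norm _) (le_trans (CauchySchwarz_rdot _ _) _).
  rewrite mulrA ler_wpM2r ?rnorm_ge0//; have := BM x; nra.
pose P := adjoint A \o A; pose Q := A \o adjoint A.
have bP : bounded_operator P := bounded_comp bA' bA.
have bQ : bounded_operator Q := bounded_comp bA bA'.
have adjl x y : inner (adjoint A x) y = inner x (A y).
  by rewrite innerC -inner_adjoint// -innerC.
have sP : selfadjoint P by move=> x y; rewrite /P /= adjl inner_adjoint.
have sQ : selfadjoint Q by move=> x y; rewrite /Q /= inner_adjoint// adjl.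
(* Since |x| <= (K + 1)|Ax| and likewise for A*, this [c] bounds both P and Q from below; K + 1 is
   nonzero even if K = 0. *)
pose c := (K + 1) ^- 2.
have K1 : 0 < K + 1 by rewrite ltr_wpDl.
have c0 : 0 < c by rewrite invr_gt0 exprn_gt0.
have low (x y : H) : rnorm x <= (K + 1) * rnorm y -> c * rnorm x ^+ 2 <= rdot y y.
  move=> xy; rewrite -rnorm_sqr mulrC ler_pdivrMr ?exprn_gt0// mulrC -exprMn.
  by rewrite ler_sqr ?nnegrE ?rnorm_ge0 ?mulr_ge0 ?rnorm_ge0// ltW.
have cP : coercive c P.
  by move=> x; rewrite rdotC /P /= -rdot_adjoint//; exact: low.
have cQ : coercive c Q.
  by move=> x; rewrite /Q /= rdot_adjoint//; exact: low.
have [Pm Qm] := AS m (mem_head _ _).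
have /AS[Pn _] : n \in [:: m; n; (m + n)%N] by rewrite !inE eqxx orbT.
have /AS[Pmn _] : (m + n)%N \in [:: m; n; (m + n)%N] by rewrite !inE eqxx !orbT.
(* (A* )^m P^n A^m = (A* )^(m+n) A^(m+n) = P^(m+n) = P^m P^n = (A* )^m A^m P^n. *)
have AmPn x : iter n P (iter m A x) = iter m A (iter n P x).
  apply: (iterA'_inj m); transitivity (iter (m + n) P x).
    by rewrite -Pmn -Pn /= (addnC m) (iterD n m A) addnC (iterD m n (adjoint A)).
  by rewrite iterD -Pm.
have AmP x : P (iter m A x) = iter m A (P x).
  apply: (intertwiner_pow (leq_trans m_gt0 le_mn) bP bP (bounded_iter m bA)
    sP sP c0 cP cP); exact: AmPn.
(* Evaluate the commutation with [P] at Bx, where A(Bx) = x. *)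
have AmA' x : adjoint A (iter m A x) = iter m A (adjoint A x).
  by have := AmP (B x); rewrite /P /= -iterS iterSr BK.
have PQm x : iter m P x = iter m Q x.
  rewrite -Pm -Qm /=.
  suff: forall k, iter k (adjoint A) (iter m A x) =
                  iter m A (iter k (adjoint A) x) by [].
  by elim=> //= k ->.
apply/funext => x.
exact: (intertwiner_pow m_gt0 bP bQ (bounded_id H) sP sQ c0 cP cQ PQm).
Qed.
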